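(* Let $L$ and $L'$ be Markovian generators on $S$ whose minimal Markov processes are irreducible and recurrent. If the loop measures associated with $L$ and $L'$ coincide, then the semigroups of the two minimal processes coincide. Thus, in the irreducible recurrent case, there is a one-to-one correspondence between the semigroup and the Markovian loop measure.
   Context: $S$ is a countable set. A Markovian generator on $S$ is a matrix $L$ with $0\le -L^x_x<\infty$, $L^x_y\ge0$ for $x\ne y$, $\sum_yL^x_y=0$. The minimal Markov process with generator $L$ is the right-continuous jump process with holding rates $-L^x_x$ and jump probabilities $L^x_y/(-L^x_x)$, killed at explosion; its semigroup is $(P_t)^x_y=\mathbb P^x[X_t=y]$. A based loop is a right-continuous piecewise-constant path $l:[0,T]\to S$, $0<T<\infty$, with finitely many jumps and $l(T)=l(T-)=l(0)$; loops are equivalence classes under time translation of periodic extensions. The loop measure associated with $L$ is the image on loops of $\sum_{x\in S}\int_0^\infty t^{-1}\mathbb P^x_t(\cdot\,;X_t=x)\,dt$, where $\mathbb P^x_t$ is the law of $(X_s)_{0\le s\le t}$ from $x$. *)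

(* Defs.v *)
From HB Require Import structures.
From mathcomp Require Import all_boot all_order all_algebra.
From mathcomp Require Import all_classical all_reals all_analysis.

Set Implicit Arguments.
Unset Strict Implicit.
Unset Printing Implicit Defensive.

Import Order.TTheory GRing.Theory Num.Theory.
Import numFieldNormedType.Exports.

Local Open Scope classical_set_scope.
Local Open Scope ring_scope.

Section MarkovLoops.
Context {R : realType} {S : countType}.

(** Markovian generator: L^x_y >= 0 for x <> y, and sum_y L^x_y = 0, i.e.
    sum_{y <> x} L^x_y = - L^x_x (finite, so 0 <= -L^x_x < oo). *)
Definition markov_generator (L : S -> S -> R) : Prop :=
  (forall x y, x != y -> 0 <= L x y) /\
  (forall x, (\esum_(y in [set y | y != x]) (L x y)%:E)%E = (- L x x)%:E).

Definition hrate (L : S -> S -> R) (x : S) : R := - L x x.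

Definition jumpP (L : S -> S -> R) (x y : S) : R :=
  if y == x then 0 else L x y / hrate L x.

(** A jump path of the process on [0,t] started at x: the successive states
    after each jump [xs] and the holding times before each jump [ds];
    [admissible x xs ds t] says the holding times are > 0, consecutive states
    differ, and all the jumps happen in [0,t] (the last state is then held
    during the remaining time, which is >= 0). *)
Fixpoint admissible (x : S) (xs : seq S) (ds : seq R) (t : R) : Prop :=
  match xs, ds with
  | y :: xs', d :: ds' => y != x /\ 0 < d /\ admissible y xs' ds' (t - d)
  | [::], [::] => 0 <= t
  | _, _ => False
  end.

(** Density of the law of the minimal process started at x on the event
    "exactly size xs jumps in [0,t], successive states xs, holding times ds":
    prod_i [ q_{x_i} e^{-q_{x_i} d_i} * L^{x_i}_{x_{i+1}} / q_{x_i} ]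
      * P(Exp(q_{x_k}) > t - sum ds). *)
Fixpoint wt (L : S -> S -> R) (x : S) (xs : seq S) (ds : seq R) (t : R) : R :=
  match xs, ds with
  | y :: xs', d :: ds' =>
      L x y * expR (- hrate L x * d) * wt L y xs' ds' (t - d)
  | _, _ => expR (- hrate L x * t)
  end.

Fixpoint iint (k : nat) (f : seq R -> \bar R) : \bar R :=
  match k with
  | 0 => f [::]
  | k.+1 => (\int[@lebesgue_measure R]_(d in [set d : R | (0 < d)%R])
              iint k (fun ds => f (d :: ds)))%E
  end.

(** The semigroup of the minimal process: (P_t)^x_y = P^x[X_t = y]
    (the process is killed at explosion, so X_t = y forces finitely many
    jumps in [0,t]). *)
Definition semigroup (L : S -> S -> R) (t : R) (x y : S) : \bar R :=
  (\esum_(xs in [set xs : seq S | last x xs = y])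
     iint (size xs) (fun ds =>
       if `[< admissible x xs ds t >] then (wt L x xs ds t)%:E else 0))%E.

(** Based loops.  A based loop l : [0,T] -> S (right-continuous, piecewise
    constant, finitely many jumps, l(T) = l(T-) = l(0)) is encoded by its
    initial state, its successive states after jumps, its holding times
    before each jump and its length T. *)
Record bloop := BLoop { bl_x : S; bl_xs : seq S; bl_ds : seq R; bl_T : R }.

Definition valid_bloop (b : bloop) : Prop :=
  admissible (bl_x b) (bl_xs b) (bl_ds b) (bl_T b) /\
  0 < bl_T b - \sum_(d <- bl_ds b) d /\
  last (bl_x b) (bl_xs b) = bl_x b.

Fixpoint seg (x : S) (xs : seq S) (ds : seq R) (s : R) : S :=
  match xs, ds with
  | y :: xs', d :: ds' => if s < d then x else seg y xs' ds' (s - d)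
  | _, _ => x
  end.

Definition bl_per (b : bloop) (s : R) : S :=
  seg (bl_x b) (bl_xs b) (bl_ds b)
      (s - bl_T b * (Num.floor (s / bl_T b))%:~R).

Definition same_loop (b b' : bloop) : Prop :=
  bl_T b = bl_T b' /\ exists u : R, forall s, bl_per b' s = bl_per b (s + u).

Definition loop_invariant (B : set bloop) : Prop :=
  forall b b', valid_bloop b -> valid_bloop b' -> same_loop b b' ->
    B b -> B b'.

Definition boxn (k : nat) (a c : nat -> R) : set (seq R) :=
  [set l | size l = k /\ forall i, (i < k)%N -> a i < nth 0 l i < c i].

Definition boreln (k : nat) : set (set (seq R)) :=
  <<s [set l : seq R | size l = k],
      [set A | exists a c, A = boxn k a c] >>.

Definition bloop_measurable (B : set bloop) : Prop :=
  forall (x : S) (xs : seq S),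
    boreln (size xs).+1
      [set l | exists ds T, l = rcons ds T /\
                  valid_bloop (BLoop x xs ds T) /\ B (BLoop x xs ds T)].

(** P^x_t( (X_s)_{0<=s<=t} in B ; X_t = x ), where the path on [0,t] is
    viewed as a based loop of length t *)
Definition loop_prob (L : S -> S -> R) (B : set bloop) (x : S) (t : R)
  : \bar R :=
  (\esum_(xs in [set xs : seq S | last x xs = x])
     iint (size xs) (fun ds =>
       if `[< admissible x xs ds t /\ valid_bloop (BLoop x xs ds t) /\
              B (BLoop x xs ds t) >]
       then (wt L x xs ds t)%:E else 0))%E.

(** the measure sum_x int_0^oo t^{-1} P^x_t(. ; X_t = x) dt on based loops;
    the loop measure is its image on loops, so it is determined by (and
    determines) its values on measurable loop-invariant sets *)
Definition based_loop_measure (L : S -> S -> R) (B : set bloop) : \bar R :=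
  (\esum_(x in [set: S])
     \int[@lebesgue_measure R]_(t in [set t : R | (0 < t)%R])
        ((t^-1)%:E * loop_prob L B x t))%E.

Definition same_loop_measure (L L' : S -> S -> R) : Prop :=
  forall B : set bloop, bloop_measurable B -> loop_invariant B ->
    based_loop_measure L B = based_loop_measure L' B.

Definition irreducible (L : S -> S -> R) : Prop :=
  forall x y, exists t : R, 0 <= t /\ (0 < semigroup L t x y)%E.

Fixpoint jprob (L : S -> S -> R) (x : S) (xs : seq S) : R :=
  match xs with
  | y :: xs' => jumpP L x y * jprob L y xs'
  | [::] => 1
  end.

(** P^x[ the process returns to x after leaving it ]: sum over the jump
    paths whose first return to x happens at their end *)
Definition return_prob (L : S -> S -> R) (x : S) : \bar R :=
  (\esum_(xs in [set xs : seq S | xs != [::] /\ last x xs = x /\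
                 forall i, (i < (size xs).-1)%N -> nth x xs i != x])
     (jprob L x xs)%:E)%E.

Definition recurrent (L : S -> S -> R) : Prop :=
  forall x, hrate L x = 0 \/ return_prob L x = 1%E.

End MarkovLoops.

(* Main.v *)
(** The loop measure determines the generator in two steps.

Holding rates are read off the constant loops. Since the law of a nonconstant loop
factors into the product of the rates L along the loop and a factor that depends on
the holding rates only, the product of L along every cycle is determined too: for
the class of all rotations of a cycle, with length in ]1, 2[, this second factor
has a finite positive mass that is the same for both generators.

For z <> x, let F(x, z) be the probability of ever reaching z from x. Multiplying
the jump probability p(z, x) by F(x, z) gives the sum of the weights of the cycles
that start with the jump z -> x and return to z once, at their end; so it is
determined by the loop measure. Irreducibility and recurrence give F(x, z) = 1,
hence p and L are determined. *)

Require Import Defs.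
From HB Require Import structures.
From mathcomp Require Import all_boot all_order all_algebra.
From mathcomp Require Import all_classical all_reals all_analysis.
From mathcomp Require Import ring lra.
Set Implicit Arguments.
Unset Strict Implicit.
Unset Printing Implicit Defensive.
Import Order.TTheory GRing.Theory Num.Theory.
Import HBNNSimple.
Local Open Scope classical_set_scope.
Local Open Scope ring_scope.

(** * Comparison of integrals and unordered sums *)

Section integral_le.
Local Open Scope ereal_scope.
Context {R : realType}.

(* The integral of a nonnegative function is by definition a supremum over the simple functions below it, also when the function is not measurable; so the iterated integrands never have to be shown measurable. *)
Lemma ge0_le_integralZ d (T : measurableType d) (mu : {measure set T -> \bar R})
    (D : set T) (f g : T -> \bar R) (c : R) : (0 <= c)%R ->
  (forall x, D x -> 0 <= f x) -> (forall x, D x -> 0 <= g x) ->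
  (forall x, D x -> f x <= c%:E * g x) ->
  \int[mu]_(x in D) f x <= c%:E * \int[mu]_(x in D) g x.
Proof.
move=> c0 f0 g0 fg.
have [c00|cn0] := eqVneq c 0%R.
  rewrite c00 mul0e le_eqVlt; apply/orP; left; apply/eqP/integral0_eq => x Dx.
  apply/eqP; rewrite eq_le f0// andbT.
  by have := fg x Dx; rewrite c00 mul0e.
have cp : (0 < c)%R by rewrite lt_neqAle eq_sym cn0.
rewrite !ge0_integralE//; apply: ge_ereal_sup => _ [h hf <-].
have h_ge0 t : (0 <= h t)%R by [].
have cV : (0 <= c^-1)%R by rewrite invr_ge0.
pose h' := scale_nnsfun h cV.
have -> : sintegral mu h = c%:E * sintegral mu h'.
  rewrite -sintegralrM; apply: eq_sintegral => x /=.
  by rewrite /h' /= mulrA mulfV// mul1r.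
rewrite lee_pmul2l//; apply: ereal_sup_ubound => /=; exists h' => // x.
have := hf x; rewrite !patchE; case: ifPn => [xD|_] hx.
- rewrite -(@lee_pmul2l _ c%:E)// -EFinM /= mulrA mulfV// mul1r.
  by apply: (le_trans hx); apply: fg; rewrite inE in xD.
- rewrite /= (_ : h x = 0%R) ?mulr0//.
  by apply/eqP; rewrite eq_le h_ge0 andbT -lee_fin.
Qed.

Lemma le_esumZ (T : choiceType) (I : set T) (f g : T -> \bar R) (c : R) :
  (0 <= c)%R -> (forall x, I x -> 0 <= g x) ->
  (forall x, I x -> f x <= c%:E * g x) ->
  \esum_(x in I) f x <= c%:E * \esum_(x in I) g x.
Proof.
move=> c0 g0 fg; apply: ge_ereal_sup => _ [X [finX XI] <-].
apply: (@le_trans _ _ (\sum_(x \in X) c%:E * g x)).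
  by apply: lee_fsum => // x Xx; apply/fg/XI.
rewrite fsbig_finite//= big_seq_cond -ge0_sume_distrr; last first.
  by move=> i; rewrite andbT in_fset_set// inE => /XI; exact: g0.
rewrite lee_wpmul2l// -big_seq_cond -fsbig_finite//.
by apply: ereal_sup_ubound; exists X.
Qed.

Lemma ge0_esumZl (T : choiceType) (I : set T) (f : T -> \bar R) (c : R) :
  (0 <= c)%R -> (forall x, I x -> 0 <= f x) ->
  \esum_(x in I) (c%:E * f x) = c%:E * \esum_(x in I) f x.
Proof.
move=> c0 f0; apply/eqP; rewrite eq_le le_esumZ//=.
have [->|cn0] := eqVneq c 0%R.
  by rewrite mul0e; apply: esum_ge0 => x _; rewrite mul0e.
have cp : (0 < c)%R by rewrite lt_neqAle eq_sym cn0.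
rewrite -(@lee_pmul2l _ (c^-1)%:E) ?lte_fin ?invr_gt0//.
rewrite muleA -EFinM mulVf// mul1e le_esumZ ?invr_ge0//.
  by move=> x Ix; rewrite mule_ge0// f0.
by move=> x Ix; rewrite muleA -EFinM mulVf// mul1e.
Qed.

Lemma esum_ge1 (T : choiceType) (I : set T) (f : T -> \bar R) (x : T) :
  I x -> f x <= \esum_(i in I) f i.
Proof.
move=> Ix; apply: esum_ge; exists [set x]; last by rewrite fsbig_set1.
by split; [exact: finite_set1|move=> _ ->].
Qed.

Lemma esum_fin_supp (T : choiceType) (I : set T) (f : T -> \bar R) (s : seq T) :
  (forall x, I x -> 0 <= f x) -> (forall x, I x -> x \notin s -> f x = 0) ->
  (forall x, I x -> f x < +oo) -> \esum_(i in I) f i < +oo.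
Proof.
move=> f0 fs fy; rewrite (esumID [set` s])//.
rewrite [X in _ + X]esum1 ?adde0; last first.
  by move=> x [Ix /negP xs]; apply: fs.
have fin : finite_set (I `&` [set` s]).
  exact/finite_setIr/finite_seq.
rewrite esum_fset//; last by move=> x; rewrite inE => -[Ix _]; exact: f0.
rewrite fsbig_finite//= big_seq; apply: lte_sum_pinfty => x.
by rewrite in_fset_set// inE => -[Ix _]; exact: fy.
Qed.

Lemma integral_itv_itv (a b c : R) : (0 <= a)%R -> (a <= b)%R -> (0 <= c)%R ->
  \int[@lebesgue_measure R]_(d in [set d : R | (0 < d)%R])
     (if (a < d < b)%R then c%:E else 0) = (c * (b - a))%:E.
Proof.
move=> a0 ab c0.
rewrite integral_mkcond (_ : _ \_ _ = (fun=> c%:E) \_ `]a, b[%classic).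
  rewrite -integral_mkcond integral_cst//= lebesgue_measure_itv/=.
  rewrite lte_fin; case: ltP => [_|ba]; first by rewrite EFinM EFinB.
  by rewrite (le_anti (introT andP (conj ab ba))) subrr mulr0 mule0.
apply/funext => d; rewrite !patchE.
have -> : (d \in `]a, b[%classic) = (a < d < b)%R by rewrite mem_setE in_itv.
case: ifPn => // /negP d0; case: ifPn => // /andP[ad _].
by case: d0; rewrite inE/=; exact: le_lt_trans ad.
Qed.

End integral_le.

(** * Iterated integrals over holding times *)

Section iterated_integral.
Local Open Scope ereal_scope.
Context {R : realType}.

Definition all_pos (ds : seq R) := all (fun d => 0 < d)%R ds.

Lemma iint_ge0 k (f : seq R -> \bar R) :
  (forall ds, size ds = k -> all_pos ds -> 0 <= f ds) -> 0 <= iint k f.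
Proof.
elim: k f => [|k IH] f f0 /=; first exact: f0.
apply: integral_ge0 => d /= d0; apply: IH => ds sds pds.
by apply: f0; rewrite /= ?sds ?d0.
Qed.

Lemma le_iintZ k (f g : seq R -> \bar R) (c : R) : (0 <= c)%R ->
  (forall ds, size ds = k -> all_pos ds -> 0 <= f ds) ->
  (forall ds, size ds = k -> all_pos ds -> 0 <= g ds) ->
  (forall ds, size ds = k -> all_pos ds -> f ds <= c%:E * g ds) ->
  iint k f <= c%:E * iint k g.
Proof.
move=> c0; elim: k f g => [|k IH] f g f0 g0 fg /=; first exact: fg.
have pos (h : seq R -> \bar R) d : (0 < d)%R ->
    (forall ds, size ds = k.+1 -> all_pos ds -> 0 <= h ds) ->
    forall ds, size ds = k -> all_pos ds -> 0 <= h (d :: ds).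
  by move=> d0 h0 ds sds pds; apply: h0; rewrite /= ?sds ?d0.
apply: ge0_le_integralZ => // d d0.
- by apply: iint_ge0; exact: pos.
- by apply: iint_ge0; exact: pos.
- apply: IH; [exact: pos|exact: pos|move=> ds sds pds].
  by apply: fg; rewrite /= ?sds ?d0.
Qed.

Lemma le_iint k (f g : seq R -> \bar R) :
  (forall ds, size ds = k -> all_pos ds -> 0 <= f ds) ->
  (forall ds, size ds = k -> all_pos ds -> f ds <= g ds) ->
  iint k f <= iint k g.
Proof.
move=> f0 fg; rewrite -[leRHS]mul1e; apply: le_iintZ => //.
  by move=> ds sds pds; rewrite (le_trans (f0 _ sds pds)) ?fg.
by move=> ds sds pds; rewrite mul1e fg.
Qed.

Lemma iint0 k : iint k (fun=> 0) = 0 :> \bar R.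
Proof. by elim: k => [//|k IH] /=; apply: integral0_eq => d _; exact: IH. Qed.

(** Serves both bounds on the mass of cycles: a box of side 2 contains the holding times of every
    loop shorter than 2, and side 1/(k+1) keeps the sum of k of them below 1. *)
Lemma iint_box k (a b : R) : (0 <= a)%R -> (0 <= b)%R ->
  iint k (fun ds => if all (fun d => 0 < d < b)%R ds then a%:E else 0) =
  (a * b ^+ k)%:E.
Proof.
move=> a0 b0; elim: k a a0 => [|k IH] a a0 /=; first by rewrite mulr1.
transitivity (\int[@lebesgue_measure R]_(d in [set d : R | (0 < d)%R])
   (if (0 < d < b)%R then (a * b ^+ k)%:E else 0)).
  apply: eq_integral => d _; case: ifPn => db /=; first exact: IH.
  exact: iint0.
by rewrite integral_itv_itv ?mulr_ge0 ?exprn_ge0// subr0 exprSr mulrA.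
Qed.

End iterated_integral.

(** * Jump paths under cutting, gluing and time translation *)

Section jump_paths.
Context {R : realType} {S : countType}.
Implicit Types (x y : S) (xs : seq S) (ds : seq R) (t s u : R).

Lemma admissible_ge0 x xs ds t : admissible x xs ds t -> 0 <= t.
Proof.
elim: xs x ds t => [|y xs IH] x [|d ds] t //= [_ [d0 /IH]].
by rewrite subr_ge0; exact: le_trans (ltW d0).
Qed.

Lemma seg_start x xs ds t : admissible x xs ds t -> seg x xs ds 0 = x.
Proof. by case: xs ds => [|y xs] [|d ds] //= [_ [-> _]]. Qed.

Lemma seg_end x xs ds t : admissible x xs ds t -> seg x xs ds t = last x xs.
Proof.
elim: xs x ds t => [|y xs IH] x [|d ds] t //= [_ [_ h]].
by rewrite ltNge -subr_ge0 (admissible_ge0 h) (IH _ _ _ h).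
Qed.

(* The interval has to be closed: a jump at time t is visible at t only. *)
Lemma seg_inj x xs ds x' xs' ds' t :
  admissible x xs ds t -> admissible x' xs' ds' t ->
  (forall s, 0 <= s <= t -> seg x xs ds s = seg x' xs' ds' s) ->
  x = x' /\ xs = xs'.
Proof.
elim: xs x ds x' xs' ds' t => [|y xs IH] x ds x' xs' ds' t a a' e.
all: have exx' : x = x'.
1,3: by rewrite -(seg_start a) -(seg_start a') e// lexx (admissible_ge0 a).
all: subst x'; split=> //.
- case: ds a e => // _ e; case: xs' ds' a' e => [//|y' xs'] [//|d' ds'] /=.
  move=> [y'x [d'0 a']] /(_ d').
  rewrite ltxx subrr (seg_start a') ltW//= -subr_ge0 (admissible_ge0 a').
  by move=> /(_ isT) exy'; rewrite exy' eqxx in y'x.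
- case: ds a e => [//|d ds] [yx [d0 a]] e.
  have dt : d <= t by rewrite -subr_ge0 (admissible_ge0 a).
  have sd : seg y xs ds 0 = y := seg_start a.
  case: xs' ds' a' e => [|y' xs'] [|d' ds'] //=.
    move=> _ /(_ d); rewrite ltxx subrr sd ltW//= dt => /(_ isT) exy.
    by rewrite exy eqxx in yx.
  move=> [y'x [d'0 a']] e.
  have d't : d' <= t by rewrite -subr_ge0 (admissible_ge0 a').
  have sd' : seg y' xs' ds' 0 = y' := seg_start a'.
  have edd' : d = d'.
    case: (ltgtP d d') => // ltd.
    + move: (e d); rewrite ltxx subrr sd ltd ltW//= dt => /(_ isT) exy.
      by rewrite exy eqxx in yx.
    + move: (e d'); rewrite ltxx subrr sd' ltd ltW//= d't => /(_ isT) exy.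
      by rewrite -exy eqxx in y'x.
  subst d'; have [|-> -> //] := IH _ _ _ _ _ _ a a'.
  move=> s /andP[s0 st]; move: (e (s + d)).
  rewrite addrK ltNge lerDr s0 /=; apply; apply/andP; split; lra.
Qed.

(* Concatenation at a time where the state does not change, so that the two holding times merge. *)
Lemma seg_cat x xs ds t y ys es u :
  admissible x xs ds t -> last x xs = y -> admissible y ys es u ->
  exists fs, admissible x (xs ++ ys) fs (t + u) /\
    forall s, seg x (xs ++ ys) fs s =
      if s < t then seg x xs ds s else seg y ys es (s - t).
Proof.
elim: xs x ds t => [|z xs IH] x ds t a /= exy b.
  subst y; have t0 := admissible_ge0 a.
  case: ys es b => [|y ys] [|e es] //= b.
    by exists [::]; split=> [|s /=]; [rewrite addr_ge0|case: ds a => //; case: ifP].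
  case: b => yx [e0 b]; exists ((t + e) :: es); split=> /=.
    rewrite (_ : t + u - (t + e) = u - e); last by ring.
    by split=> //; split=> //; lra.
  move=> s; have [st|st] := ltP s t.
    by case: ds a => // _; rewrite ifT//; lra.
  by rewrite ltrBlDl (_ : s - (t + e) = s - t - e)//; ring.
case: ds a => [//|d ds] [zx [d0 a]].
have [fs [af efs]] := IH _ _ _ a exy b; exists (d :: fs); split=> /=.
  by rewrite (_ : t + u - d = t - d + u); [|ring].
have dt : d <= t by rewrite -subr_ge0 (admissible_ge0 a).
move=> s; rewrite efs ltrD2r; have [sd|sd] := ltP s d.
  by rewrite ifT//; lra.
by have [//|st] := ltP s t; congr seg; ring.
Qed.

(** A jump exactly at time u is put into the first piece, so that the agreement with that piece
    includes s = u. *)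
Lemma seg_split x xs ds t u : admissible x xs ds t -> 0 <= u <= t ->
  exists j es fs, [/\ admissible x (take j xs) es u,
    admissible (last x (take j xs)) (drop j xs) fs (t - u),
    forall s, s <= u -> seg x xs ds s = seg x (take j xs) es s &
    forall s, 0 <= s ->
      seg x xs ds (s + u) = seg (last x (take j xs)) (drop j xs) fs s].
Proof.
elim: xs x ds t u => [|y xs IH] x ds t u.
  case: ds => //= t0 /andP[u0 ut]; exists 0%N, [::], [::].
  by split=> //=; rewrite subr_ge0.
case: ds => [//|d ds] [yx [d0 a]] /andP[u0 ut].
have [ud|du] := ltP u d.
  exists 0%N, [::], ((d - u) :: ds); split=> //=.
  - rewrite subr_gt0 (_ : t - u - (d - u) = t - d)//; by ring.
  - by move=> s su; rewrite (le_lt_trans su).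
  - by move=> s s0; rewrite ltrBrDr (_ : s + u - d = s - (d - u))//; ring.
have u1 : 0 <= u - d <= t - d by apply/andP; split; lra.
have [j [es [fs [a1 a2 e1 e2]]]] := IH _ _ _ _ a u1.
exists j.+1, (d :: es), fs; split=> //=.
- by rewrite (_ : t - u = t - d - (u - d))//; ring.
- by move=> s su; case: ltP => // ds'; apply: e1; rewrite lerD2r.
- move=> s s0; rewrite ifF; first by rewrite -addrA e2.
  by apply/negbTE; rewrite -leNgt; lra.
Qed.

Lemma bl_per_seg (b : bloop (R := R) (S := S)) (n : nat) s : 0 < bl_T b ->
  0 <= s < bl_T b ->
  bl_per b (s + n%:R * bl_T b) = seg (bl_x b) (bl_xs b) (bl_ds b) s.
Proof.
move=> T0 /andP[s0 sT]; rewrite /bl_per.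
have -> : Num.floor ((s + n%:R * bl_T b) / bl_T b) = n :> int.
  apply: floor_def; rewrite mulrDl mulfK ?gt_eqF// intrD.
  rewrite -!pmulrn lerDr divr_ge0 ?(ltW T0)//= addrC.
  by rewrite ltrD2l ltr_pdivrMr// mul1r.
by congr seg; rewrite -pmulrn; ring.
Qed.

Lemma bl_per_shift (b : bloop (R := R) (S := S)) (m : int) s : 0 < bl_T b ->
  bl_per b (s + m%:~R * bl_T b) = bl_per b s.
Proof.
move=> T0; rewrite /bl_per.
have -> : (s + m%:~R * bl_T b) / bl_T b = s / bl_T b + m%:~R.
  by rewrite mulrDl mulfK ?gt_eqF.
by rewrite floorDrz ?intr_int// intrKfloor intrD; congr seg; ring.
Qed.

(** Cutting the path of b at the translation time and swapping the two pieces gives a path that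
    agrees with that of b', and by [seg_inj] a path has only one sequence of states. The holding
    times are not rotated in the same way, since the cut may split one of them. *)
Lemma same_loop_rot (b b' : bloop (R := R) (S := S)) :
  valid_bloop b -> valid_bloop b' -> same_loop b b' ->
  exists j, bl_x b' = last (bl_x b) (take j (bl_xs b)) /\
            bl_xs b' = rot j (bl_xs b).
Proof.
move=> [a [r lst]] [a' [r' lst']] [eT [u0 eu0]].
have T0 : 0 < bl_T b.
  apply: (lt_le_trans r); rewrite gerBl.
  elim: (bl_xs b) (bl_x b) (bl_ds b) (bl_T b) a {r lst eT eu0 lst' r' a'} =>
    [|y xs IH] x [|d ds] t //=; rewrite ?big_nil// big_cons.
  by move=> [_ [d0 /IH]]; apply: addr_ge0; exact: ltW.
(* The translation is reduced modulo the period, so that the cut falls inside the loop. *)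
have [u [u_ge0 uT eu]] : exists u, [/\ 0 <= u, u < bl_T b &
    forall s, bl_per b' s = bl_per b (s + u)].
  have [/= l1 l2] := andP (floor_itv (u0 / bl_T b)).
  exists (u0 - bl_T b * (Num.floor (u0 / bl_T b))%:~R); split.
  - by rewrite subr_ge0 mulrC -ler_pdivlMr.
  - rewrite ltrBlDr -[X in X + _]mulr1 -mulrDr mulrC -ltr_pdivrMr//.
    by rewrite addrC -[1]/(1%:~R) -intrD.
  - move=> s; rewrite eu0 -[RHS](bl_per_shift (Num.floor (u0 / bl_T b)))//.
    by congr bl_per; ring.
have uT' : 0 <= u <= bl_T b by rewrite u_ge0 ltW.
have [j [es [fs [a1 a2 e1 e2]]]] := seg_split a uT'.
have lst2 : last (last (bl_x b) (take j (bl_xs b))) (drop j (bl_xs b)) = bl_x b.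
  by rewrite -last_cat cat_take_drop.
have [gs [a3 e3]] := seg_cat a2 lst2 a1.
rewrite subrK in a3; exists j; apply: (seg_inj a'); first by rewrite -eT; exact: a3.
have f0 s : 0 <= s < bl_T b -> bl_per b s = seg (bl_x b) (bl_xs b) (bl_ds b) s.
  by move=> sT; rewrite -[RHS](@bl_per_seg _ 0)// mul0r addr0.
have f0' s : 0 <= s < bl_T b -> bl_per b' s = seg (bl_x b') (bl_xs b') (bl_ds b') s.
  move=> sT; rewrite -[RHS](@bl_per_seg _ 0)// -?eT// mul0r addr0//.
(* At s = T the periodic path has already wrapped around, so the endpoint is compared through the
   last states of the pieces. *)
rewrite -eT => s /andP[s0]; rewrite le_eqVlt => /orP[/eqP ->|sT].
  have -> : seg (bl_x b') (bl_xs b') (bl_ds b') (bl_T b) = bl_x b'.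
    by rewrite eT (seg_end a').
  rewrite e3 ltNge gerBl u_ge0 /= (_ : bl_T b - (bl_T b - u) = u); last by ring.
  rewrite (seg_end a1) -(seg_start a') -f0' ?lexx//= eu add0r f0 ?u_ge0//.
  by rewrite e1// (seg_end a1).
rewrite -f0' ?s0// eu e3; case: ltP => su.
  by rewrite -e2// f0//; apply/andP; split; lra.
rewrite -e1; last by lra.
rewrite -(@bl_per_seg _ 1)//; last by apply/andP; split; lra.
by rewrite mul1r; congr bl_per; ring.
Qed.

End jump_paths.

(** * Measurable, invariant sets of loops with prescribed cycles *)

Section cycle_sets.
Context {R : realType} {S : countType}.
Implicit Types (x y : S) (xs : seq S) (ds : seq R) (t s u : R).
Implicit Types (P : S -> seq S -> Prop).

Definition jump_chain x xs := path (fun y z => z != y) x xs.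

Lemma admissibleP x xs ds t : admissible x xs ds t <->
  [/\ jump_chain x xs, size ds = size xs, all_pos ds & \sum_(d <- ds) d <= t].
Proof.
elim: xs x ds t => [|y xs IH] x [|d ds] t /=; rewrite ?big_nil; [by split=> //; case|..].
1,2: by split=> //; case.
rewrite big_cons -lerBrDl; split.
  by move=> [-> [-> /IH[-> -> -> ->]]].
move=> [/andP[-> c] [sz] /andP[-> p] le]; split=> //; split=> //; exact/IH.
Qed.

Lemma valid_bloopP x xs ds t : valid_bloop (BLoop x xs ds t) <->
  [/\ jump_chain x xs, last x xs = x, size ds = size xs, all_pos ds
     & \sum_(d <- ds) d < t].
Proof.
rewrite /valid_bloop /= subr_gt0; split.
  by move=> [/admissibleP[? ? ? ?] [? ?]].
by move=> [ch lst sz p lt]; split=> //; apply/admissibleP; rewrite ltW.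
Qed.

(** The window for the length keeps 1/t and, for each sequence of states, the exponential factors
    between positive constants. *)
Definition cycle_set P : set (bloop (R := R) (S := S)) :=
  [set b | 1 < bl_T b < 2 /\ P (bl_x b) (bl_xs b)].

Definition rot_closed P := forall x xs j, last x xs = x ->
  P x xs -> P (last x (take j xs)) (rot j xs).

Lemma cycle_set_invariant P : rot_closed P -> loop_invariant (cycle_set P).
Proof.
move=> rP b b' vb vb' bb' [T12 Pb]; split; first by rewrite -(proj1 bb').
have [j [-> ->]] := same_loop_rot vb vb' bb'.
by apply: rP => //; case: vb => _ [].
Qed.

(** Supplies the rational parameters that turn the condition on the sum into a countable union of
    boxes. *)
Lemma rat_majorant ds t : \sum_(d <- ds) d < t ->
  exists q : seq rat, [/\ size q = size ds,
    forall i, (i < size ds)%N -> nth 0 ds i < ratr (nth 0 q i) &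
    \sum_(a <- q) ratr a < t].
Proof.
elim: ds t => [|d ds IH] t; first by rewrite !big_nil => t0; exists [::]; rewrite big_nil.
rewrite big_cons -ltrBrDr => /rat_in_itvoo[a]; rewrite in_itv/= => /andP[da at'].
have [|q [sq dq qt]] := IH (t - ratr a); first by rewrite ltrBrDl -ltrBrDr.
exists (a :: q); split=> /=; [by rewrite sq|by case|].
by rewrite big_cons addrC -ltrBrDr.
Qed.

Lemma boreln_holding_times k : boreln k.+1
  [set l | exists ds t, [/\ l = rcons ds t, size ds = k, all_pos ds,
    \sum_(d <- ds) d < t & 1 < t < 2]].
Proof.
(* One box per rational tuple q of size k: the holding times stay below q and the length above its
   sum. All other codes give the empty set. *)
pose box (o : option (seq rat)) : set (seq R) := if o is Some q then
  if size q == k then boxn k.+1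
    (fun i => if (i < k)%N then 0 else Num.max 1 (\sum_(a <- q) ratr a))
    (fun i => if (i < k)%N then ratr (nth 0 q i) else 2) else set0 else set0.
have mbox o : boreln k.+1 (box o).
  rewrite /box; case: o => [q|]; last exact: sigma_algebra0.
  case: ifP => _; last exact: sigma_algebra0.
  by apply: sub_sigma_algebra; eexists; eexists.
rewrite [X in boreln _ X](_ : _ = \bigcup_n box (unpickle n)).
  by apply: sigma_algebra_bigcup => n; exact: mbox.
apply/seteqP; split=> [l [ds [t [-> sds pds dst /andP[t1 t2]]]]|l [n _]].
  have [q [sq dq qt]] := rat_majorant dst.
  exists (pickle q) => //; rewrite pickleK /box sq sds eqxx; split.
    by rewrite size_rcons sds.
  move=> i; rewrite ltnS leq_eqVlt nth_rcons sds => /orP[/eqP ->|ik].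
    by rewrite ltnn eqxx t2 gt_max t1 qt.
  by rewrite ik dq ?sds// andbT (allP pds)// mem_nth// sds.
case: (unpickle n) => [q|//]; rewrite /box; case: eqP => [sq|//] [].
case/lastP: l => [//|ds t]; rewrite size_rcons => -[sds] bx.
exists ds, t; have := bx k (ltnSn k); rewrite nth_rcons sds ltnn eqxx gt_max.
move=> /andP[/andP[t1 qt] t2].
have bx' i : (i < k)%N -> 0 < nth 0 ds i < ratr (nth 0 q i).
  by move=> ik; have := bx i (ltnW ik); rewrite nth_rcons sds ik.
split=> //; rewrite ?t1//.
  by apply/(all_nthP 0) => i; rewrite sds => /bx'/andP[].
apply: le_lt_trans qt; rewrite (big_nth 0) [leRHS](big_nth 0) sds sq.
rewrite !big_mkord; apply: ler_sum => i _.
by have /andP[_ /ltW] := bx' i (ltn_ord i).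
Qed.

(** For fixed states P is a constant, so each section is either empty or the set of all holding
    times and lengths allowed by the window; hence P can be arbitrary. *)
Lemma cycle_set_measurable P : bloop_measurable (cycle_set P).
Proof.
move=> x xs; have [[ch lst Px]|nP] := pselect [/\ jump_chain x xs, last x xs = x & P x xs].
  rewrite [X in boreln _ X](_ : _ =
    [set l | exists ds t, [/\ l = rcons ds t, size ds = size xs, all_pos ds,
    \sum_(d <- ds) d < t & 1 < t < 2]]); first exact: boreln_holding_times.
  apply/seteqP; split=> l [ds [t h]]; exists ds, t.
    by case: h => -> [/valid_bloopP[_ _ -> -> ->] [/= -> _]].
  by case: h => -> sds pds dst t12; split=> //; split=> //; exact/valid_bloopP.
rewrite [X in boreln _ X](_ : _ = set0).
  exact: sigma_algebra0.
apply/seteqP; split=> // l [ds [t [_ [/valid_bloopP[ch lst _ _ _] [_ Px]]]]].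
exact: nP.
Qed.

End cycle_sets.

(** * Factorization of path densities *)

Section path_weights.
Context {R : realType} {S : countType}.
Implicit Types (x y : S) (xs : seq S) (ds : seq R) (t : R) (L : S -> S -> R).

Fixpoint path_weight L x xs : R :=
  if xs is y :: xs' then L x y * path_weight L y xs' else 1.

(** The rates enter through an arbitrary function q, so this factor becomes literally the same for
    both generators once their holding rates agree. *)
Fixpoint hold_weight (q : S -> R) x xs ds t : R :=
  match xs, ds with
  | y :: xs', d :: ds' => expR (- q x * d) * hold_weight q y xs' ds' (t - d)
  | _, _ => expR (- q x * t)
  end.

Lemma wtE L x xs ds t : size ds = size xs ->
  wt L x xs ds t = path_weight L x xs * hold_weight (hrate L) x xs ds t.
Proof.
elim: xs x ds t => [|y xs IH] x [|d ds] t //=; first by rewrite mul1r.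
by move=> [sz]; rewrite IH//; ring.
Qed.

Lemma path_weight_cat L x xs ys :
  path_weight L x (xs ++ ys) = path_weight L x xs * path_weight L (last x xs) ys.
Proof. by elim: xs x => [|y xs IH] x /=; rewrite ?mul1r// IH mulrA. Qed.

(** The product of rates around a closed path does not depend on the starting point: rotating swaps
    the two factors of a concatenation. The last hypothesis says that x is where the rotated cycle
    starts. *)
Lemma path_weight_rot L x z xs j : xs != [::] -> last z xs = z ->
  last x (rot j xs) = x -> path_weight L x (rot j xs) = path_weight L z xs.
Proof.
move=> xs0 lz lx; rewrite -[in RHS](cat_take_drop j xs) path_weight_cat.
have : last (last z (take j xs)) (drop j xs) = z by rewrite -last_cat cat_take_drop.
move: lx; rewrite /rot path_weight_cat last_cat.
case E: (drop j xs) => [|y ys] /=.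
  move: (cat_take_drop j xs); rewrite E cats0 => -> lx _; rewrite mul1r mulr1.
  by case: xs xs0 lz lx {E} => //= a s _ -> ->.
by move=> lx lz'; rewrite lz' in lx *; rewrite lx mulrC.
Qed.

Section generator.
Context {L : S -> S -> R} (genL : markov_generator L).

Lemma hrate_ge0 x : 0 <= hrate L x.
Proof.
rewrite -lee_fin -(proj2 genL x); apply: esum_ge0 => y yx.
by rewrite lee_fin; apply: (proj1 genL); rewrite eq_sym.
Qed.

Lemma path_weight_ge0 x xs : jump_chain x xs -> 0 <= path_weight L x xs.
Proof.
elim: xs x => [|y xs IH] x //= /andP[yx /IH]; apply: mulr_ge0.
by apply: (proj1 genL); rewrite eq_sym.
Qed.

Lemma hold_weight_gt0 (q : S -> R) x xs ds t : 0 < hold_weight q x xs ds t.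
Proof.
elim: xs x ds t => [|y xs IH] x [|d ds] t /=; rewrite ?expR_gt0//.
by rewrite mulr_gt0// expR_gt0.
Qed.

Lemma hold_weight_le1 x xs ds t : admissible x xs ds t ->
  hold_weight (hrate L) x xs ds t <= 1.
Proof.
have exp_le1 (y : S) (s : R) : 0 <= s -> expR (- hrate L y * s) <= 1.
  by move=> s0; rewrite -expR0 ler_expR mulNr oppr_le0 mulr_ge0// hrate_ge0.
elim: xs x ds t => [|y xs IH] x [|d ds] t //=; first exact: exp_le1.
move=> [_ [d0 /IH h1]]; rewrite mulr_ile1 ?expR_ge0// ?exp_le1 ?ltW//.
exact: hold_weight_gt0.
Qed.

(** No holding time exceeds 2, so each exponential is at least e^(-2q); the bound depends on the
    states but not on the holding times. *)
Lemma hold_weight_lower_bound x xs : exists2 m : R, 0 < m &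
  forall ds t, admissible x xs ds t -> t <= 2 ->
    m <= hold_weight (hrate L) x xs ds t.
Proof.
have exp_ge (y : S) (s : R) : s <= 2 -> expR (- hrate L y * 2) <= expR (- hrate L y * s).
  by move=> s2; rewrite ler_expR !(mulNr (hrate L y)) lerN2 ler_wpM2l// hrate_ge0.
elim: xs x => [|y xs IH] x.
  exists (expR (- hrate L x * 2)); first exact: expR_gt0.
  by case=> //= t _; exact: exp_ge.
have [m m0 hm] := IH y; exists (expR (- hrate L x * 2) * m).
  by rewrite mulr_gt0// expR_gt0.
case=> [//|d ds] t [_ [d0 a]] t2 /=; apply: ler_pM; rewrite ?expR_ge0 ?(ltW m0)//.
  by apply: exp_ge; have := admissible_ge0 a; lra.
by apply: hm => //; lra.
Qed.

Lemma wt_ge0 x xs ds t : admissible x xs ds t -> 0 <= wt L x xs ds t.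
Proof.
move=> /admissibleP[ch sz _ _]; rewrite wtE// mulr_ge0 ?path_weight_ge0//.
exact/ltW/hold_weight_gt0.
Qed.

End generator.
End path_weights.

(** * Finite positive mass of cycle sets *)

Section loop_measure_of_cycle_sets.
Local Open Scope ereal_scope.
Context {R : realType} {S : countType}.
Implicit Types (x y : S) (xs : seq S) (ds : seq R) (t : R) (P : S -> seq S -> Prop).

Definition loop_weight (L : S -> S -> R) (B : set (bloop (R := R) (S := S))) x xs t ds :=
  if `[< admissible x xs ds t /\ valid_bloop (BLoop x xs ds t) /\
              B (BLoop x xs ds t) >]
  then (wt L x xs ds t)%:E else 0.

Section one_generator.
Context {L : S -> S -> R} (genL : markov_generator L).
Context (B : set (bloop (R := R) (S := S))).

Lemma loop_weight_ge0 x xs t ds : 0 <= loop_weight L B x xs t ds.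
Proof.
rewrite /loop_weight; case: asboolP => // -[a _].
by rewrite lee_fin wt_ge0.
Qed.

Lemma iint_loop_weight_ge0 x xs t :
  0 <= iint (size xs) (loop_weight L B x xs t).
Proof. by apply: iint_ge0 => ds _ _; exact: loop_weight_ge0. Qed.

Lemma loop_prob_ge0 x t : 0 <= loop_prob L B x t.
Proof. by apply: esum_ge0 => xs _; exact: iint_loop_weight_ge0. Qed.

Lemma loop_density_ge0 x t : (0 < t)%R -> 0 <= (t^-1)%:E * loop_prob L B x t.
Proof.
by move=> t0; rewrite mule_ge0 ?loop_prob_ge0// lee_fin invr_ge0 ltW.
Qed.

End one_generator.

Lemma based_loop_measure_le (L L' : S -> S -> R) B (c : R) :
  markov_generator L -> markov_generator L' -> (0 <= c)%R ->
  (forall x xs ds t, valid_bloop (BLoop x xs ds t) -> B (BLoop x xs ds t) ->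
     (wt L' x xs ds t <= c * wt L x xs ds t)%R) ->
  based_loop_measure L' B <= c%:E * based_loop_measure L B.
Proof.
move=> gL gL' c0 le_wt; rewrite /based_loop_measure; apply: le_esumZ => // x _.
  by apply: integral_ge0 => t t0; exact: loop_density_ge0.
apply: ge0_le_integralZ => // t t0; rewrite ?loop_density_ge0//.
rewrite muleCA lee_wpmul2l ?lee_fin ?invr_ge0 ?(ltW t0)// /loop_prob.
apply: le_esumZ => // xs _; first exact: iint_loop_weight_ge0.
apply: le_iintZ => // ds _ _; rewrite -/(loop_weight _ _ _ _ _ _).
- exact: loop_weight_ge0.
- exact: loop_weight_ge0.
- rewrite /loop_weight; case: asboolP => [[_ [v b]]|_]; last by rewrite mule0.
  by rewrite -EFinM lee_fin le_wt.
Qed.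

Lemma cycle_set_measure_fin (L : S -> S -> R) P (X : seq S) (Y : seq (seq S)) :
  markov_generator L -> (forall x xs, P x xs -> x \in X /\ xs \in Y) ->
  based_loop_measure L (cycle_set P) < +oo.
Proof.
move=> gL PXY; pose B := cycle_set (R := R) P.
have lp0 x t : x \notin X -> loop_prob L B x t = 0.
  move=> xX; apply: esum1 => xs _; rewrite -[RHS](iint0 (size xs)); congr iint.
  apply/funext => ds; case: asboolP => // -[_ [_ [_ /PXY[]]]] /=.
  by rewrite (negbTE xX).
apply: (@esum_fin_supp _ _ _ _ X) => [x _|x _ xX|x _].
- by apply: integral_ge0 => t t0; exact: loop_density_ge0.
- by apply: integral0_eq => t _; rewrite lp0// mule0.
(* The exponentials are at most 1 and each holding time lies in ]0, 2[, so a path with k jumps has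
   mass at most its rate product times 2^k. *)
pose K := \esum_(xs in [set xs | last x xs = x])
  (if (xs \in Y) && jump_chain x xs
   then (path_weight L x xs * 2 ^+ size xs)%:E else 0).
have pw0 xs : jump_chain x xs -> (0 <= path_weight L x xs * 2 ^+ size xs)%R.
  by move=> ch; rewrite mulr_ge0 ?exprn_ge0// path_weight_ge0.
have K0 : 0 <= K.
  by apply: esum_ge0 => xs _; case: ifP => // /andP[_ ch]; rewrite lee_fin pw0.
have Kfin : K \is a fin_num.
  rewrite ge0_fin_numE//; apply: (@esum_fin_supp _ _ _ _ Y) => xs _.
  + by case: ifP => // /andP[_ ch]; rewrite lee_fin pw0.
  + by move=> /negbTE ->.
  + by case: ifP => _; exact: ltry.
apply: (@le_lt_trans _ _ (\int[@lebesgue_measure R]_(t in [set t : R | (0 < t)%R])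
     (if (1 < t < 2)%R then (fine K)%:E else 0))); last first.
  by rewrite integral_itv_itv ?ltry// ?ler1n// fine_ge0.
rewrite -[leRHS]mul1e; apply: ge0_le_integralZ => // t t0.
- exact: loop_density_ge0.
- by case: ifP => //; rewrite fineK.
rewrite mul1e fineK//; case: ifPn => t12; last first.
  rewrite (_ : loop_prob _ _ _ _ = 0) ?mule0//.
  apply: esum1 => xs _; rewrite -[RHS](iint0 (size xs)); congr iint.
  by apply/funext => ds; case: asboolP => // -[_ [_ []]] /=; rewrite (negbTE t12).
have [t1 t2] := andP t12.
apply: (@le_trans _ _ (loop_prob L B x t)).
  rewrite -[leRHS]mul1e lee_wpmul2r ?loop_prob_ge0// lee_fin.
  by rewrite invf_le1// ltW.
apply: le_esum => xs _; case: ifPn => [/andP[_ ch]|nch]; last first.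
  rewrite (_ : iint _ _ = 0)// -[RHS](iint0 (size xs)); congr iint.
  apply/funext => ds; case: asboolP => // -[/admissibleP[ch _ _ _] [_ [_ /PXY[_ /= xsY]]]].
  by rewrite xsY ch in nch.
rewrite -iint_box ?path_weight_ge0//; apply: le_iint => ds sds pds.
  exact: loop_weight_ge0.
case: asboolP => [[a _]|_]; last by case: ifP; rewrite // lee_fin path_weight_ge0.
rewrite ifT.
  rewrite lee_fin wtE// -[leRHS]mulr1 ler_wpM2l ?path_weight_ge0//.
  exact: hold_weight_le1.
have /admissibleP[_ _ _ le] := a.
apply/allP => d dds; rewrite (allP pds)//=.
apply: le_lt_trans t2; apply: le_trans le.
rewrite (big_rem d)//= lerDl big_seq; apply: sumr_ge0 => e /mem_rem eds.
exact/ltW/(allP pds).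
Qed.

Lemma cycle_set_measure_gt0 (L : S -> S -> R) P x xs :
  markov_generator L -> P x xs -> jump_chain x xs -> last x xs = x ->
  (0 < path_weight L x xs)%R -> 0 < based_loop_measure L (cycle_set P).
Proof.
move=> gL Px ch lst pw0.
have [m m0 hm] := hold_weight_lower_bound gL x xs.
(* With k holding times below 1/(k+1), all jumps happen before time 1, so a single box fits every
   length in the window. The factor 1/2 below bounds 1/t. *)
pose k := size xs; pose b : R := (k.+1%:R^-1)%R.
have b0 : (0 < b)%R by rewrite invr_gt0 ltr0n.
have [c cE] : exists c, c = (path_weight L x xs * m * b ^+ k)%R by eexists.
have c0 : (0 < c)%R by rewrite cE !mulr_gt0// exprn_gt0.
apply: (@lt_le_trans _ _ (2^-1 * c)%:E); first by rewrite lte_fin mulr_gt0 ?invr_gt0.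
apply: le_trans (@esum_ge1 _ _ [set: S] _ x I).
rewrite (_ : (2^-1 * c)%:E = \int[@lebesgue_measure R]_(t in [set t : R | (0 < t)%R])
     (if (1 < t < 2)%R then (2^-1 * c)%:E else 0)); last first.
  rewrite integral_itv_itv ?ler1n// ?mulr_ge0 ?invr_ge0 ?(ltW c0)//.
  by congr EFin; lra.
rewrite -[leRHS]mul1e; apply: ge0_le_integralZ => // t t0.
- by case: ifP => // _; rewrite lee_fin mulr_ge0 ?invr_ge0 ?(ltW c0).
- exact: loop_density_ge0.
rewrite mul1e; case: ifPn => t12; last exact: loop_density_ge0.
have [t1 t2] := andP t12.
rewrite EFinM; apply: lee_pmul; rewrite ?lee_fin ?invr_ge0 ?(ltW c0)//.
  by rewrite lef_pV2 ?posrE// ltW.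
apply: le_trans (@esum_ge1 _ _ [set zs | last x zs = x] _ xs lst).
rewrite cE -iint_box ?(ltW b0) ?mulr_ge0 ?(ltW pw0) ?(ltW m0)//.
apply: le_iint => ds sds pds.
  by case: ifP => // _; rewrite lee_fin mulr_ge0 ?(ltW pw0) ?(ltW m0).
case: ifPn => [/allP db|_]; last exact: loop_weight_ge0.
have dst : (\sum_(d <- ds) d < t)%R.
  apply: le_lt_trans t1; apply: (@le_trans _ _ (\sum_(d <- ds) b)%R).
    by rewrite !big_seq; apply: ler_sum => d /db/andP[_ /ltW].
  rewrite big_const_seq count_predT iter_addr_0 sds -mulr_natl.
  by rewrite ler_pdivrMr ?ltr0n// mul1r ler_nat.
have a : admissible x xs ds t by apply/admissibleP; rewrite ltW.
rewrite asboolT; last by split=> //; split=> //; exact/valid_bloopP.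
by rewrite lee_fin wtE// ler_pM2l// hm// ltW.
Qed.

(** The cycle set has the same mass M for both generators, and comparing densities gives M <= c M.
    As M is positive and finite, c cannot be below 1. *)
Lemma cycle_set_measure_neq (L L' : S -> S -> R) P (X : seq S) (Y : seq (seq S)) x xs (c : R) :
  markov_generator L -> markov_generator L' -> same_loop_measure L L' ->
  rot_closed P -> (forall y ys, P y ys -> y \in X /\ ys \in Y) ->
  P x xs -> jump_chain x xs -> last x xs = x -> (0 < path_weight L x xs)%R ->
  (0 <= c)%R ->
  (forall y ys ds t, valid_bloop (BLoop y ys ds t) -> (1 < t < 2)%R -> P y ys ->
     (wt L' y ys ds t <= c * wt L y ys ds t)%R) ->
  (1 <= c)%R.
Proof.
move=> gL gL' same rP PXY Px ch lst pw0 c0 le_wt.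
have M0 := cycle_set_measure_gt0 gL Px ch lst pw0.
have Moo := cycle_set_measure_fin gL PXY.
have : based_loop_measure L' (cycle_set P) <= c%:E * based_loop_measure L (cycle_set P).
  by apply: based_loop_measure_le => // y ys ds t v [t12 Py]; exact: le_wt.
rewrite -same; [|exact: cycle_set_measurable|exact: cycle_set_invariant].
move: M0 Moo; case: based_loop_measure => [r| |]//.
by rewrite lte_fin -EFinM lee_fin => r0 _; rewrite ler_pMl.
Qed.

End loop_measure_of_cycle_sets.

(** * Holding rates and cycle products from the loop measure *)

Section identification.
Context {R : realType} {S : countType} (L L' : S -> S -> R).
Hypotheses (gL : markov_generator L) (gL' : markov_generator L').
Hypothesis same : same_loop_measure L L'.

(** Constant loops of length t at x have density e^(-q t). If q' > q, then for t > 1 the ratio of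
    the densities is at most e^(-(q' - q)) < 1. *)
Lemma loop_measure_hrate_le x : hrate L' x <= hrate L x.
Proof.
rewrite leNgt; apply/negP => lt.
suff : 1 <= expR (- (hrate L' x - hrate L x)).
  by rewrite -expR0 ler_expR; lra.
apply: (@cycle_set_measure_neq _ _ L L' (fun y ys => y = x /\ ys = [::])
  [:: x] [:: [::]] x [::]) => //=; rewrite ?expR_ge0//.
- by move=> y ys j _ [-> ->].
- by move=> y ys [-> ->]; rewrite !inE.
- move=> y ys ds t _ /andP[t1 _] [-> ->] /=.
  rewrite -expRD ler_expR; nra.
Qed.

(** On the rotations of w the ratio of the densities is constant, equal to the ratio of the rate
    products; if the inequality failed, this constant would be below 1. *)
Lemma loop_measure_cycle_le z w :
  hrate L = hrate L' -> jump_chain z w -> last z w = z ->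
  path_weight L z w <= path_weight L' z w.
Proof.
have [-> //|w0] := eqVneq w [::]; move=> qq ch lst.
rewrite leNgt; apply/negP => lt.
have pw0 := le_lt_trans (path_weight_ge0 gL' ch) lt.
have c0 : 0 <= path_weight L' z w / path_weight L z w.
  by rewrite divr_ge0 ?path_weight_ge0.
suff : 1 <= path_weight L' z w / path_weight L z w.
  by rewrite ler_pdivlMr// mul1r leNgt lt.
(* The base point is only required to be a state of w; that it fits the rotation comes from the
   validity of the loop. *)
pose P x xs := x \in w /\ exists2 j, (j <= size w)%N & xs = rot j w.
apply: (@cycle_set_measure_neq _ _ L L' P w
  [seq rot j w | j <- iota 0 (size w).+1] z w) => //.
- move=> x xs j lx [xw [i iw xsE]]; split; last first.
    have [jw|jw] := leqP j (size xs); last by exists i; rewrite // rot_oversize// ltnW.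
    rewrite xsE size_rot in jw *.
    exists (if j + i <= size w then j + i else j + i - size w)%N.
      by case: ifP => // _; rewrite leq_subLR leq_add.
    by rewrite rot_add_mod.
  have := mem_last x (take j xs); rewrite inE => /predU1P[->//|].
  by move=> /mem_take; rewrite xsE mem_rot.
- by move=> y ys [yw [j jw ->]]; split=> //; apply/mapP; exists j; rewrite ?mem_iota.
- split; last by exists 0%N; rewrite ?rot0.
  by case: (w) w0 lst => //= a s _ <-; exact: mem_last.
- move=> y ys ds t v _ [_ [j _ ysE]].
  have /valid_bloopP[_ ly sz _ _] := v.
  rewrite !wtE// qq mulrA ler_pM2r ?hold_weight_gt0//.
  by rewrite ysE !(@path_weight_rot _ _ _ y z)// -?ysE// divfK// gt_eqF.
Qed.

End identification.

(** * Hitting probabilities of the jump chain *)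

Section hitting_probabilities.
Local Open Scope ereal_scope.
Context {R : realType} {S : countType}.
Implicit Types (x y z : S) (xs : seq S).

(* [hitting_paths z z] is the index set of [return_prob]. *)
Definition hitting_paths x z : set (seq S) :=
  [set xs | xs != [::] /\ last x xs = z /\
     forall i, (i < (size xs).-1)%N -> nth x xs i != z].

Lemma hitting_paths_cons x z y xs : hitting_paths x z (y :: xs) <->
  (y = z /\ xs = [::]) \/ (y <> z /\ hitting_paths y z xs).
Proof.
split=> [[_ [/= lst h]]|[[-> ->]|[yz [xs0 [lst h]]]]].
- case: xs lst h => [|a s] lst h; [by left|right; split].
    by apply/eqP; exact: (h 0%N).
  (* The default of [nth] changes with the head of the path; indices in range do not see it. *)
  split=> //; split=> // i ilt; rewrite (set_nth_default x); last exact: (leq_trans ilt).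
  exact: (h i.+1).
- by split.
- split=> //; split=> // -[|i] /= ilt; first exact/eqP.
  rewrite (set_nth_default y); first by apply: h; case: (xs) ilt.
  exact: ltnW.
Qed.

Section one_generator.
Context {L : S -> S -> R} (genL : markov_generator L).

Definition hit_prob x z := \esum_(xs in hitting_paths x z) (jprob L x xs)%:E.

(** Truncation by the number of jumps allows an induction from 0, where there is no hitting path. *)
Definition hit_prob_within n x z :=
  \esum_(xs in hitting_paths x z `&` [set xs | (size xs <= n)%N]) (jprob L x xs)%:E.

Lemma jumpP_ge0 x y : (0 <= jumpP L x y)%R.
Proof.
rewrite /jumpP; case: eqVneq => // yx; apply: divr_ge0; last exact: hrate_ge0.
by apply: (proj1 genL); rewrite eq_sym.
Qed.

Lemma jprob_ge0 x xs : (0 <= jprob L x xs)%R.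
Proof.
by elim: xs x => [|y xs IH] x //=; rewrite mulr_ge0 ?jumpP_ge0.
Qed.

Lemma hit_prob_within_rec n x z : hit_prob_within n.+1 x z =
  (jumpP L x z)%:E +
  \esum_(y in [set y | y <> z]) ((jumpP L x y)%:E * hit_prob_within n y z).
Proof.
rewrite /hit_prob_within (esumID [set [:: z]]); last first.
  by move=> xs _; rewrite lee_fin jprob_ge0.
congr (_ + _).
  rewrite [X in esum X _](_ : _ = [set [:: z]]).
    by rewrite esum_set1 /= ?mulr1// lee_fin jumpP_ge0.
  have hz : hitting_paths x z [:: z] by apply/hitting_paths_cons; left.
  by apply/seteqP; split=> [xs [_ ->]//|_ ->].
transitivity (\esum_(y in [set y | y <> z])
    \esum_(xs in hitting_paths y z `&` [set xs | (size xs <= n)%N])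
       ((jumpP L x y)%:E * (jprob L y xs)%:E)); last first.
  apply: eq_esum => y _; rewrite ge0_esumZl ?jumpP_ge0// => xs _.
  by rewrite lee_fin jprob_ge0.
rewrite esum_esum; last first.
  by move=> y xs _ _; rewrite mule_ge0 ?lee_fin ?jumpP_ge0 ?jprob_ge0.
under [RHS]eq_esum do rewrite -EFinM.
apply: (@reindex_esum _ _ _ _ _ (fun k : S * seq S => k.1 :: k.2)
  (fun xs => (jprob L x xs)%:E)).
split=> [[y xs] /= [yz [h sn]]|[y xs] [y' xs'] _ _ /= [-> ->]//|].
  split; last by case=> _; case: h => /eqP.
  by split=> //; apply/hitting_paths_cons; right.
case=> [|y xs] [[h sn] ne]; first by case: h.
have /hitting_paths_cons[[yz xs0]|[yz h']] := h; first by subst; case: ne.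
by exists (y, xs).
Qed.

Lemma esum_jumpP x : hrate L x != 0%R ->
  \esum_(y in [set: S]) (jumpP L x y)%:E = 1.
Proof.
move=> q0; have := proj2 genL x; rewrite -/(hrate L x) esum_mkcond => e.
transitivity ((hrate L x)^-1%:E * (hrate L x)%:E); last by rewrite -EFinM mulVf.
rewrite -e -ge0_esumZl ?invr_ge0 ?hrate_ge0//.
  apply: eq_esum => y _; rewrite /jumpP; case: eqVneq => [->|yx].
    by rewrite memNset ?mule0//= eqxx.
  by rewrite mem_set// -EFinM mulrC.
move=> y _; case: ifPn => //; rewrite inE /= => yx.
by rewrite lee_fin; apply: (proj1 genL); rewrite eq_sym.
Qed.

Hypothesis q_neq0 : forall x, hrate L x != 0%R.

Lemma jumpP_split x z : (jumpP L x z)%:E +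
  \esum_(y in [set y | y <> z]) (jumpP L x y)%:E = 1.
Proof.
rewrite -(esum_jumpP (q_neq0 x)) [RHS](esumID [set z]); last first.
  by move=> y _; rewrite lee_fin jumpP_ge0.
by rewrite !setTI esum_set1// lee_fin jumpP_ge0.
Qed.

Lemma hit_prob_within_le1 n x z : hit_prob_within n x z <= 1.
Proof.
elim: n x => [|n IH] x.
  rewrite /hit_prob_within esum1// => xs [[xs0 _]] /=.
  by case: (xs) xs0.
rewrite hit_prob_within_rec -(jumpP_split x z) leeD2l//.
apply: le_esum => y _; rewrite -[leRHS]mule1 lee_wpmul2l//.
by rewrite lee_fin jumpP_ge0.
Qed.

(** Finitely many paths have bounded lengths, so every finite partial sum is below a truncated
    probability. *)
Lemma hit_prob_sup x z (c : \bar R) :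
  (forall n, hit_prob_within n x z <= c) -> hit_prob x z <= c.
Proof.
move=> le_c; apply: ge_ereal_sup => _ [X [finX XI] <-].
have [n Xn] : exists n, forall xs, X xs -> (size xs <= n)%N.
  exists (\max_(xs <- finmap.enum_fset (fset_set X)) size xs)%N => xs Xxs.
  by apply: leq_bigmax_seq => //; rewrite in_fset_set// inE.
apply: le_trans (le_c n); apply: ereal_sup_ubound; exists X => //.
by split=> // xs Xxs; split; [exact: XI|exact: Xn].
Qed.

Lemma hit_prob_within_le n x z : hit_prob_within n x z <= hit_prob x z.
Proof.
rewrite /hit_prob (esumID [set xs | (size xs <= n)%N]) ?leeDl//.
  by apply: esum_ge0 => xs _; rewrite lee_fin jprob_ge0.
by move=> xs _; rewrite lee_fin jprob_ge0.
Qed.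

Lemma hit_prob_ge0 x z : 0 <= hit_prob x z.
Proof. by apply: esum_ge0 => xs _; rewrite lee_fin jprob_ge0. Qed.

Lemma hit_prob_le1 x z : hit_prob x z <= 1.
Proof. by apply: hit_prob_sup => n; exact: hit_prob_within_le1. Qed.

Lemma hit_prob_le_rec x z : hit_prob x z <= (jumpP L x z)%:E +
  \esum_(y in [set y | y <> z]) ((jumpP L x y)%:E * hit_prob y z).
Proof.
have rhs0 y : 0 <= (jumpP L x y)%:E * hit_prob y z.
  by rewrite mule_ge0 ?hit_prob_ge0// lee_fin jumpP_ge0.
apply: hit_prob_sup => -[|n].
  rewrite /hit_prob_within esum1; last first.
    by move=> xs [[xs0 _]] /=; case: (xs) xs0.
  by rewrite adde_ge0 ?esum_ge0// lee_fin jumpP_ge0.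
rewrite hit_prob_within_rec leeD2l//; apply: le_esum => y _.
by rewrite lee_wpmul2l ?hit_prob_within_le// lee_fin jumpP_ge0.
Qed.

(** By the first-step inequality, 1 is at most an average of numbers that are at most 1, so none of
    positive weight can be smaller than 1. *)
Lemma hit_prob_step x y z : hit_prob x z = 1 -> (0 < jumpP L x y)%R -> y <> z ->
  hit_prob y z = 1.
Proof.
move=> hx p0 yz; apply/eqP; rewrite eq_le hit_prob_le1/= leNgt; apply/negP => hy.
have pfin : hit_prob y z \is a fin_num.
  by rewrite ge0_fin_numE ?hit_prob_ge0// (lt_le_trans hy)// ltW// ltry.
have := hit_prob_le_rec x z; rewrite hx -{1}(jumpP_split x z).
rewrite !(esumID [set y] [set w | w <> z]); first last.
- by move=> w _; rewrite lee_fin jumpP_ge0.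
- by move=> w _; rewrite mule_ge0 ?hit_prob_ge0// lee_fin jumpP_ge0.
have -> : [set w | w <> z] `&` [set y] = [set y].
  by apply/seteqP; split=> [w []//|w ->].
rewrite !esum_set1 ?mule_ge0 ?hit_prob_ge0 ?lee_fin ?jumpP_ge0//.
set r := \esum_(w in _) (jumpP L x w)%:E; set s := \esum_(w in _) _.
have sr : s <= r.
  apply: le_esum => w _; rewrite -[leRHS]mule1 lee_wpmul2l ?hit_prob_le1//.
  by rewrite lee_fin jumpP_ge0.
have r0 : 0 <= r by apply: esum_ge0 => w _; rewrite lee_fin jumpP_ge0.
(* Finiteness of r keeps the inequality strict when the remaining terms are added. *)
have rfin : r \is a fin_num.
  rewrite ge0_fin_numE//; apply: (@le_lt_trans _ _ 1); last exact: ltry.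
  rewrite -(esum_jumpP (q_neq0 x)) [leRHS](esumID ([set w | w <> z] `&` ~` [set y])).
    by rewrite setTI leeDl// esum_ge0// => w _; rewrite lee_fin jumpP_ge0.
  by move=> w _; rewrite lee_fin jumpP_ge0.
apply/negP; rewrite -ltNge.
rewrite lteD2lE//.
apply: (@le_lt_trans _ _ ((jumpP L x y)%:E * hit_prob y z + r)); first exact: leeD2l.
rewrite lteD2rE// -[ltRHS]mule1 lte_pmul2l//.
Qed.

(** Iterates [hit_prob_step]; when the path visits z, that lemma does not apply and the return
    hypothesis takes over. *)
Lemma hit_prob_path x xs z : hit_prob z z = 1 ->
  jump_chain x xs -> (0 < path_weight L x xs)%R -> hit_prob x z = 1 ->
  hit_prob (last x xs) z = 1.
Proof.
move=> hz; elim: xs x => [//|y xs IH] x /= /andP[yx ch] pw hx.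
have L0 : (0 <= L x y)%R by apply: (proj1 genL); rewrite eq_sym.
have Lp : (0 < L x y)%R.
  by rewrite lt_neqAle L0 andbT eq_sym; apply: contraTneq pw => ->; rewrite mul0r ltxx.
apply: IH => //; first by rewrite pmulr_rgt0 in pw.
have [->//|yz] := pselect (y = z); apply: hit_prob_step hx _ yz.
by rewrite /jumpP (negbTE yx) divr_gt0// lt_neqAle eq_sym q_neq0 hrate_ge0.
Qed.

End one_generator.

(** If every such path had zero rate product, all densities in [semigroup] would vanish at every
    time. *)
Lemma irreducible_path (L : S -> S -> R) x y : markov_generator L -> irreducible L ->
  exists xs, [/\ jump_chain x xs, last x xs = y & (0 < path_weight L x xs)%R].
Proof.
move=> gL /(_ x y)[t [t0]]; apply: contraPP => no.
apply/negP; rewrite -leNgt le_eqVlt; apply/orP; left; apply/eqP.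
apply: esum1 => xs lst; rewrite -[RHS](iint0 (size xs)); congr iint.
apply/funext => ds; case: asboolP => // /admissibleP[ch sz _ _].
rewrite wtE// (_ : path_weight L x xs = 0%R) ?mul0r//.
apply/eqP; rewrite eq_le path_weight_ge0// andbT leNgt; apply/negP => pw.
by apply: no; exists xs.
Qed.

(** With two states at hand, each w must lead to another state, so some positive rate leaves w. *)
Lemma irreducible_hrate_neq0 (L : S -> S -> R) x z : markov_generator L -> irreducible L ->
  x != z -> forall w, hrate L w != 0%R.
Proof.
move=> gL irr xz w.
have [v vw] : exists v, v != w.
  by case: (eqVneq x w) => [<-|xw]; [exists z; rewrite eq_sym|exists x].
have [[|a s] [ch lst pw]] := irreducible_path w v gL irr.
  by rewrite /= in lst; rewrite lst eqxx in vw.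
have /andP[aw ch'] := ch.
have La : (0 < L w a)%R.
  have L0 : (0 <= L w a)%R by apply: (proj1 gL); rewrite eq_sym.
  by rewrite lt_neqAle L0 andbT eq_sym; apply: contraTneq pw => /= ->; rewrite mul0r ltxx.
apply/negP => /eqP q0; have := proj2 gL w; rewrite -/(hrate L w) q0.
have := @esum_ge1 R S [set y | y != w] (fun y => (L w y)%:E) a aw.
by move=> /[swap] ->; rewrite lee_fin leNgt La.
Qed.

(** Recurrence makes the return to z certain, a zero rate being excluded; a path of positive weight
    from z to x then carries certainty over to x. *)
Lemma hit_prob_eq1 (L : S -> S -> R) x z : markov_generator L -> irreducible L ->
  recurrent L -> x != z -> hit_prob (L := L) x z = 1.
Proof.
move=> gL irr rec xz; have q0 := irreducible_hrate_neq0 gL irr xz.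
have hz : hit_prob (L := L) z z = 1.
  by have [q|//] := rec z; have := q0 z; rewrite q eqxx.
have [xs [ch <- pw]] := irreducible_path z x gL irr.
exact: hit_prob_path.
Qed.

End hitting_probabilities.

(** * Determination of the generator *)

Section determination.
Context {R : realType} {S : countType}.
Implicit Types (x y z : S) (xs : seq S) (L : S -> S -> R).

Lemma jprobE L x xs : jprob L x xs = if jump_chain x xs then
  path_weight L x xs / \prod_(y <- belast x xs) hrate L y else 0.
Proof.
elim: xs x => [|y xs IH] x /=; first by rewrite big_nil divr1.
rewrite big_cons IH /jumpP; case: eqVneq => [_|yx] /=; first by rewrite mul0r.
by case: ifP => _; rewrite ?mulr0// invfM; ring.
Qed.

Lemma same_loop_measure_sym L L' : same_loop_measure L L' -> same_loop_measure L' L.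
Proof. by move=> same B mB iB; rewrite same. Qed.

Lemma loop_measure_hrate L L' : markov_generator L -> markov_generator L' ->
  same_loop_measure L L' -> hrate L = hrate L'.
Proof.
move=> gL gL' same; apply/funext => x; apply/eqP; rewrite eq_le.
by rewrite !loop_measure_hrate_le//; exact: same_loop_measure_sym.
Qed.

Lemma loop_measure_cycle L L' z w : markov_generator L -> markov_generator L' ->
  same_loop_measure L L' -> last z w = z -> jprob L z w = jprob L' z w.
Proof.
move=> gL gL' same lz; have qq := loop_measure_hrate gL gL' same.
rewrite !jprobE qq; case: ifP => // ch; congr (_ / _).
by apply/eqP; rewrite eq_le !loop_measure_cycle_le//; exact: same_loop_measure_sym.
Qed.

Lemma loop_measure_generator L L' : markov_generator L -> markov_generator L' ->
  irreducible L -> recurrent L -> irreducible L' -> recurrent L' ->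
  same_loop_measure L L' -> L = L'.
Proof.
move=> gL gL' irr rec irr' rec' same.
have qq := loop_measure_hrate gL gL' same.
apply/funext => z; apply/funext => x; have [<-|xz] := eqVneq x z.
  by apply: oppr_inj; have := congr1 (@^~ x) qq.
(* Inserting the factor [hit_prob x z = 1] turns the jump probability into a sum over cycles at
   z. *)
have jumpE M : markov_generator M -> irreducible M -> recurrent M ->
    ((jumpP M z x)%:E =
     \esum_(xs in hitting_paths x z) (jprob M z (x :: xs))%:E)%E.
  move=> gM iM rM; rewrite -[LHS]mule1 -(hit_prob_eq1 gM iM rM xz) -ge0_esumZl.
  - by apply: eq_esum => xs _; rewrite -EFinM.
  - exact: jumpP_ge0.
  - by move=> xs _; rewrite lee_fin jprob_ge0.
have : jumpP L z x = jumpP L' z x.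
  apply: EFin_inj; rewrite !jumpE//; apply: eq_esum => xs [_ [lst _]].
  by rewrite (loop_measure_cycle gL gL' same).
(* Both jump probabilities are rates divided by the same nonzero holding rate of z. *)
rewrite /jumpP (negbTE xz) qq; apply: mulIf.
by rewrite invr_eq0 -qq; exact: (irreducible_hrate_neq0 gL irr xz).
Qed.

End determination.

Theorem mainTheorem7 (R : realType) (S : countType) (L L' : S -> S -> R) :
  markov_generator L -> markov_generator L' ->
  irreducible L -> recurrent L ->
  irreducible L' -> recurrent L' ->
  same_loop_measure L L' ->
  forall (t : R) (x y : S), 0 <= t -> semigroup L t x y = semigroup L' t x y.
Proof.
move=> gL gL' irr rec irr' rec' same t x y _.
by rewrite (loop_measure_generator gL gL' irr rec irr' rec' same).
Qed.
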